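(* Let $\nu_0$ be a probability measure on $[0,1]$ with $\nu_0((\frac12,1])>0$. Then there exists $k\in\mathbb{N}$ such that the following holds whenever $W>1$ and $(W-1)/\sigma_W$ (with $\sigma_W>0$) are large enough: if $\tilde\nu_0$ is the probability measure on pairs $(p,\varepsilon)$ whose $p$-marginal is $\nu_0$ and whose conditional law of $\varepsilon$ given $p$ is the Gaussian $\mathcal{N}(0,\sigma_W^2)$ truncated to the interval $(a(p),b(p))$ with $a(p)=-(W-1)p$, $b(p)=(W-1)(1-p)$, and $\mu$ is any probability measure on $([0,1]\times\mathbb{R})^{\mathbb{N}}$ with $\mu\ll\mu_0:=\prod_{n=1}^\infty\tilde\nu_0$, then $\mu(\mathcal{C}_I^w)=1$.
   Context: For a sequence $((p_i,\varepsilon_i))_{i=1}^\infty$ define weights $w_i:=1+(W-1)p_i^k+\varepsilon_i$ (so $w_i\in[1,W]$ under the truncation above). Let $X_1,X_2,\dots$ be independent random variables with values in $\{-1,+1\}$ and $\mathbb{P}(X_i=1)=p_i$. $\mathcal{C}_I^w$ is the set of sequences $((p_i,\varepsilon_i))_{i=1}^\infty$ for which the weighted Condorcet Jury Property holds: $\lim_{n\to\infty}\mathbb{P}\left(\sum_{i=1}^n w_iX_i>0\right)=1$. $\mu\ll\mu_0$ denotes absolute continuity. *)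

(* Defs.v *)
From HB Require Import structures.
From mathcomp Require Import all_boot all_order all_algebra.
From mathcomp Require Import all_classical all_reals all_analysis.
Set Implicit Arguments. Unset Strict Implicit. Unset Printing Implicit Defensive.
Import Order.TTheory GRing.Theory Num.Theory.
Import numFieldNormedType.Exports.
Local Open Scope classical_set_scope.
Local Open Scope ring_scope.

Section defs.
Variable R : realType.

(* Generators of the product sigma-algebra on ([0,1] x R)^N (realised on
   (R x R)^N): preimages of Borel rectangles under a single coordinate. *)
Definition coord_rects : set (set (nat -> R * R)) :=
  [set C | exists (i : nat) (A B : set R), measurable A /\ measurable B /\
      C = [set x | A (x i).1 /\ B (x i).2]].

Definition SeqSpace := g_sigma_algebraType coord_rects.

Definition trunc_normal (sigma a b : R) (B : set R) : R :=
  fine (normal_prob 0 sigma (B `&` `]a, b[)) / fine (normal_prob 0 sigma `]a, b[).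

Definition tr_a (W p : R) : R := - ((W - 1) * p).
Definition tr_b (W p : R) : R := (W - 1) * (1 - p).

Definition nu_tilde (nu0 : probability R R) (W sigma : R) (A B : set R) : \bar R :=
  (\int[nu0]_(p in A) (trunc_normal sigma (tr_a W p) (tr_b W p) B)%:E)%E.

(* mu0 is the infinite product measure prod_n nu0tilde: it agrees with the
   product of the marginals on all finite-dimensional measurable rectangles
   (this determines mu0 uniquely on the product sigma-algebra). *)
Definition is_product_measure (nu0 : probability R R) (W sigma : R)
    (mu0 : probability SeqSpace R) : Prop :=
  forall (n : nat) (A B : nat -> set R),
    (forall i, measurable (A i) /\ measurable (B i)) ->
    mu0 [set x : SeqSpace | forall i, (i < n)%N -> A i (x i).1 /\ B i (x i).2]
    = (\prod_(i < n) nu_tilde nu0 W sigma (A i) (B i))%E.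

Definition weight (W : R) (k : nat) (pe : R * R) : R :=
  1 + (W - 1) * pe.1 ^+ k + pe.2.

(* P(sum_{i<n} w_i X_i > 0) for independent X_i in {-1,+1} with
   P(X_i = 1) = p_i, written as the sum over outcomes of the product law. *)
Definition vote_prob (W : R) (k : nat) (x : nat -> R * R) (n : nat) : R :=
  \sum_(s : {ffun 'I_n -> bool} |
          0 < \sum_(i < n) weight W k (x i) * (if s i then 1 else -1))
    \prod_(i < n) (if s i then (x i).1 else 1 - (x i).1).

Definition CJP_set (W : R) (k : nat) : set SeqSpace :=
  [set x | (vote_prob W k x n) @[n --> \oo] --> (1 : R)].

End defs.

(* Main.v *)
Require Import Defs.
From HB Require Import structures.
From mathcomp Require Import all_boot all_order all_algebra.
From mathcomp Require Import all_classical all_reals all_analysis.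
From mathcomp Require Import measurable_realfun ring lra.
Set Implicit Arguments.
Unset Strict Implicit.
Unset Printing Implicit Defensive.
Import Order.TTheory GRing.Theory Num.Theory.
Import numFieldNormedType.Exports.
Local Open Scope classical_set_scope.
Local Open Scope ring_scope.

(** Given the sequence [x], Chernoff's bound with parameter [t] gives
    P(sum_i w_i X_i <= 0) <= prod_i g (x_i), where
    g (p, e) = p exp(-tw) + (1 - p) exp(tw) <= 1 - t w (2p - 1) + 2 (tw)^2.
    On four rectangles, according to whether [p >= h] (for some [h > 1/2] with
    nu0 [h, +oo[ > 0) and whether [|e|] exceeds a small multiple of [W - 1], the
    drift w (2p - 1) has a constant lower bound, so [g] is dominated by a step
    function.  Large [k] makes [h^k] win over [2^-k], and large [(W - 1) / sigma]
    makes large noise improbable, so for small [t] this step function has mean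
    rho < 1.  The product measure is only needed on rectangles to see that the
    expected probability of a wrong outcome is at most rho^n; being summable in
    [n], it forces the probability itself to tend to 0 almost surely. *)

(** * Chernoff's bound for a fixed sequence of voters *)

Section chernoff.
Variable R : realType.
Implicit Types (p t u w W : R) (k n : nat) (x : nat -> R * R).

(** From exp(-u) >= 1 - u one gets exp(u) (1 - u) <= 1, while (1 + u + 2 u^2) (1 - u) = 1 + u^2 (1 -
    2 u) >= 1. It remains to cancel 1 - u > 0. *)
Lemma expR_le_quadratic u : u <= 2^-1 -> expR u <= 1 + u + 2 * u ^+ 2.
Proof.
move=> u2; have Nu := expR_ge1Dx (- u).
have Eu : expR u * expR (- u) = 1 by rewrite -expRD subrr expR0.
have e0 := expR_gt0 u.
have : expR u * (1 - u) <= 1 by rewrite -[leRHS]Eu ler_pM2l.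
have u20 : 0 <= u ^+ 2 * (1 - 2 * u) by rewrite mulr_ge0 ?sqr_ge0//; lra.
have E2 : u ^+ 2 * (1 - 2 * u) = (1 + u + 2 * u ^+ 2) * (1 - u) - 1 by ring.
by move=> H; rewrite -(@ler_pM2r _ (1 - u)); lra.
Qed.

Lemma two_point_mgf_le p t w : 0 <= p <= 1 -> `|t * w| <= 2^-1 ->
  p * expR (- (t * w)) + (1 - p) * expR (t * w)
  <= 1 - t * (w * (2 * p - 1)) + 2 * (t * w) ^+ 2.
Proof.
move=> /andP[p0 p1] /[!ler_norml] /andP[lo up].
have Hp := @expR_le_quadratic (t * w) up.
have Hm := @expR_le_quadratic (- (t * w)) ltac:(lra).
have A1 : p * expR (- (t * w)) <= p * (1 + - (t * w) + 2 * (- (t * w)) ^+ 2).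
  exact: ler_wpM2l.
have A2 : (1 - p) * expR (t * w) <= (1 - p) * (1 + t * w + 2 * (t * w) ^+ 2).
  by apply: ler_wpM2l => //; lra.
apply: (le_trans (lerD A1 A2)); rewrite sqrrN; set v := t * w.
suff -> : t * (w * (2 * p - 1)) = v * (2 * p - 1) by lra.
by rewrite mulrA.
Qed.

Lemma sum_outcomes n (a b : 'I_n -> R) :
  \sum_(s : {ffun 'I_n -> bool}) \prod_(i < n) (if s i then a i else b i)
  = \prod_(i < n) (a i + b i).
Proof.
pose F (i : 'I_n) (j : bool) := if j then a i else b i.
transitivity (\sum_(s : {ffun 'I_n -> bool}) \prod_(i < n) F i (s i)) => //.
rewrite -(bigA_distr_bigA F); apply: eq_bigr => i _.
by rewrite big_bool.
Qed.

(** On outcomes whose weighted sum S is at most 0, exp(-t S) >= 1; the mean of exp(-t S) factorises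
    over the independent voters. *)
Lemma vote_prob_bounds W k t x n : 0 <= t ->
    (forall i, (i < n)%N -> 0 <= (x i).1 <= 1) ->
  vote_prob W k x n <= 1 /\
  1 - vote_prob W k x n <=
  \prod_(i < n) ((x i).1 * expR (- (t * weight W k (x i)))
                 + (1 - (x i).1) * expR (t * weight W k (x i))).
Proof.
move=> t0 x01.
pose S (s : {ffun 'I_n -> bool}) :=
  \sum_(i < n) weight W k (x i) * (if s i then 1 else -1).
pose P (s : {ffun 'I_n -> bool}) :=
  \prod_(i < n) (if s i then (x i).1 else 1 - (x i).1).
have P0 s : 0 <= P s.
  apply: prodr_ge0 => i _; have /andP[? ?] := x01 i (ltn_ord i).
  by case: (s i) => //; rewrite subr_ge0.
have sumP : \sum_s P s = 1.
  rewrite /P sum_outcomes big1// => i _; lra.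
have voteC : 1 - vote_prob W k x n = \sum_(s | ~~ (0 < S s)) P s.
  rewrite -sumP (bigID (fun s => 0 < S s)) /= addrC; exact: addrK.
split; first by rewrite -subr_ge0 voteC sumr_ge0.
rewrite voteC.
have -> : \prod_(i < n) ((x i).1 * expR (- (t * weight W k (x i)))
    + (1 - (x i).1) * expR (t * weight W k (x i)))
    = \sum_s P s * expR (- (t * S s)).
  rewrite -sum_outcomes; apply: eq_bigr => s _.
  rewrite /P /S mulr_sumr -sumrN expR_sum -big_split; apply: eq_bigr => i _.
  by case: (s i); rewrite ?mulr1 ?mulrN1 ?mulrN ?opprK.
rewrite [leRHS](bigID (fun s => 0 < S s)) /= -[leLHS]add0r; apply: lerD.
  by apply: sumr_ge0 => s _; rewrite mulr_ge0 ?expR_ge0.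
apply: ler_sum => s; rewrite -leNgt => Ss; rewrite ler_peMr//.
rewrite -expR0 ler_expR oppr_ge0; exact: mulr_ge0_le0.
Qed.

End chernoff.

(** * Almost sure convergence from summable means *)

Section summable_means.
Context d (T : measurableType d) (R : realType).
Variable P : {measure set T -> \bar R}.

(** Integrating termwise, the sum of all [f n] has a mean bounded by a geometric series. It is
    therefore finite almost everywhere, and the terms of a convergent series tend to 0. *)
Lemma ae_cvg0_geometric_mean (f : nat -> T -> R) (rho : R) :
    (forall n, measurable_fun setT (f n)) -> (forall n x, 0 <= f n x) ->
    0 <= rho < 1 ->
    (forall n, (\int[P]_x (f n x)%:E <= (rho ^+ n)%:E)%E) ->
  \forall x \ae P, f n x @[n --> \oo] --> (0 : R).
Proof.
move=> mf f0 /andP[r0 r1] If.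
pose F (x : T) : \bar R := (\sum_(n <oo) (f n x)%:E)%E.
have mF : @measurable_fun _ _ T (\bar R) setT F.
  by apply: ge0_emeasurable_sum => //= n *; [rewrite lee_fin|exact/measurable_EFinP].
have F0 x : (0 <= F x)%E by apply: nneseries_ge0 => *; rewrite lee_fin.
have intF : P.-integrable setT F.
  apply/integrableP; split => //.
  under eq_integral do rewrite gee0_abs//.
  rewrite integral_nneseries//; last first.
  - by move=> *; rewrite lee_fin.
  - by move=> n; apply/measurable_EFinP.
  apply: (@le_lt_trans _ _ (\sum_(n <oo) (rho ^+ n)%:E)%E).
    by apply: lee_nneseries => // n _ _; apply: integral_ge0 => *; rewrite lee_fin.
  have := @cvg_geometric_series _ 1 rho.
  rewrite ger0_norm// => /(_ r1) cv.
  suff -> : (\sum_(n <oo) (rho ^+ n)%:E = ((1 * (1 - rho)^-1)%:E))%E by rewrite ltry.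
  apply/cvg_lim => //; apply: cvg_EFin.
    by apply: nearW => n; rewrite sumEFin.
  apply: cvg_trans cv; apply: near_eq_cvg; apply: nearW => n.
  rewrite /series /= sumEFin /=.
  by apply: eq_bigr => i _; rewrite /geometric/= mul1r.
have := integrable_ae measurableT intF; apply: filterS => x /(_ I) Fx.
apply: cvg_series_cvg_0; apply: nondecreasing_is_cvgn.
  by apply: nondecreasing_series => n _.
exists (fine (F x)) => _ [n _ <-].
rewrite -lee_fin fineK// /series/= -sumEFin.
by apply: (nneseries_lim_ge n) => i *; rewrite lee_fin.
Qed.

End summable_means.

(** * Measurability of the jury property *)

Section measurability.
Variable R : realType.
Implicit Types (W : R) (k n i : nat).

Lemma measurable_norm_gt (r : R) : measurable [set z : R | r < `|z|].
Proof.
rewrite (_ : [set _ | _] = (@Num.norm R R) @^-1` `]r, +oo[%classic).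
  by rewrite -[X in measurable X]setTI; exact: normr_measurable.
by apply/seteqP; split => z /=; rewrite in_itv/= andbT.
Qed.

Lemma measurable_rectangle i (A B : set R) : measurable A -> measurable B ->
  measurable [set x : SeqSpace R | A (x i).1 /\ B (x i).2].
Proof.
by move=> mA mB; apply: sub_sigma_algebra; exists i, A, B.
Qed.

Lemma measurable_coord1 i :
  measurable_fun [set: SeqSpace R] (fun x : SeqSpace R => (x i).1).
Proof.
move=> _ A mA; rewrite setTI.
rewrite (_ : _ @^-1` _ = [set x : SeqSpace R | A (x i).1 /\ setT (x i).2]).
  exact: measurable_rectangle.
by apply/seteqP; split => x //= -[].
Qed.

Lemma measurable_coord2 i :
  measurable_fun [set: SeqSpace R] (fun x : SeqSpace R => (x i).2).
Proof.
move=> _ A mA; rewrite setTI.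
rewrite (_ : _ @^-1` _ = [set x : SeqSpace R | setT (x i).1 /\ A (x i).2]).
  exact: measurable_rectangle.
by apply/seteqP; split => x //= -[].
Qed.

Lemma measurable_weight W k i :
  measurable_fun [set: SeqSpace R] (fun x : SeqSpace R => weight W k (x i)).
Proof.
apply: measurable_funD; last exact: measurable_coord2.
apply: measurable_funD => //; apply: measurable_funM => //.
by apply: measurable_funX; exact: measurable_coord1.
Qed.

Lemma measurable_vote_prob W k n :
  measurable_fun [set: SeqSpace R] (fun x : SeqSpace R => vote_prob W k x n).
Proof.
(* The set of winning outcomes varies with [x]; the conditional form sums over a fixed index set. *)
pose F (s : {ffun 'I_n -> bool}) (x : SeqSpace R) : R :=
  if 0 < \sum_(i < n) weight W k (x i) * (if s i then 1 else -1)
  then \prod_(i < n) (if s i then (x i).1 else 1 - (x i).1) else 0.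
rewrite (_ : (fun x => _) = (fun x => \sum_s F s x)); last first.
  by apply/funext => x; rewrite /vote_prob big_mkcond.
apply: measurable_sum => s; apply: measurable_fun_ifT => //.
  apply: measurable_fun_ltr => //; apply: measurable_sum => i.
  by apply: measurable_funM => //; exact: measurable_weight.
apply: measurable_prod => i _; case: (s i); first exact: measurable_coord1.
by apply: measurable_funB => //; exact: measurable_coord1.
Qed.

(** Testing convergence on the radii 1/(m+1) only makes all set operations countable. *)
Lemma measurable_cvg_cst d (T : measurableType d) (f : nat -> T -> R) (l : R) :
  (forall n, measurable_fun setT (f n)) ->
  measurable [set x | f n x @[n --> \oo] --> l].
Proof.
move=> mf.
pose E m n := [set x : T | `|l - f n x| < m.+1%:R^-1].
rewrite (_ : [set _ | _] = \bigcap_m \bigcup_N \bigcap_(n in [set n | (N <= n)%N]) E m n).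
  apply: bigcapT_measurable => m; apply: bigcupT_measurable => N.
  apply: bigcap_measurable => [|n _]; first by exists N => /=.
  have mg : measurable_fun setT (fun x => `|l - f n x|).
    by apply: measurableT_comp => //; exact: measurable_funB.
  have := measurable_fun_ltr mg (measurable_cst (m.+1%:R^-1 : R)).
  by move=> /(_ measurableT [set true] I); rewrite setTI.
apply/seteqP; split => x /=.
  move=> /cvgrPdist_lt cv m _.
  have /cv[N _ HN] : 0 < (m.+1%:R^-1 : R) by rewrite invr_gt0.
  by exists N.
move=> H; apply/cvgrPdist_lt => e e0.
have [m me] : exists m : nat, m.+1%:R^-1 < e.
  have [m Hm] := ltr_add_invr (y := 0) e0.
  by exists m; rewrite add0r in Hm.
have [N _ HN] := H m I.
by exists N => // n /= Nn; apply: lt_trans me; exact: HN.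
Qed.

Lemma measurable_CJP_set W k : measurable (CJP_set (R := R) W k).
Proof. apply: measurable_cvg_cst => n; exact: measurable_vote_prob. Qed.

End measurability.

(** * Tail estimate for the truncated Gaussian *)

Section truncated_normal.
Variables (R : realType) (sigma : R).
Hypothesis sigma0 : 0 < sigma.
Implicit Types (a b r z W p delta : R) (B V : set R).

Let pdf z : R := normal_pdf 0 sigma z.

Let pdfE z : pdf z = normal_peak sigma * expR (- (z ^+ 2 / (2 * sigma ^+ 2))).
Proof.
rewrite /pdf normal_pdfE ?gt_eqF// /normal_fun subr0 mulNr.
by rewrite -[in X in - X](mulr_natl (sigma ^+ 2) 2).
Qed.

Let pdf_gt0 z : 0 < pdf z.
Proof. by rewrite pdfE mulr_gt0 ?expR_gt0// normal_peak_gt0 ?gt_eqF. Qed.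

(** The exponent depends on z through z^2 only. Both interval estimates below integrate this
    comparison. *)
Let pdf_anti z r : `|z| <= `|r| -> pdf r <= pdf z.
Proof.
move=> zr; rewrite !pdfE ler_pM2l ?normal_peak_gt0 ?gt_eqF// ler_expR lerN2.
rewrite ler_pM2r ?invr_gt0 ?mulr_gt0 ?exprn_gt0//.
by rewrite -(real_normK (num_real z)) -(real_normK (num_real r)) ler_sqr ?nnegrE.
Qed.

Let measurable_pdf V : measurable_fun V (fun z => (normal_pdf 0 sigma z)%:E).
Proof. by apply/measurable_EFinP/measurable_funTS; exact: measurable_normal_pdf. Qed.

Lemma normal_prob_itv_ge a b r : a <= b ->
    (forall z, a < z < b -> `|z| <= `|r|) ->
  (b - a) * normal_pdf 0 sigma r <= fine (normal_prob 0 sigma `]a, b[).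
Proof.
move=> ab H; rewrite -lee_fin fineK ?fin_num_measure//.
rewrite mulrC EFinM -[(b - a)%:E](_ : lebesgue_measure `]a, b[%classic = _); last first.
  rewrite lebesgue_measure_itv/= lte_fin; case: ltP => // ba.
  by have -> : a = b; [apply/le_anti; rewrite ab|rewrite subrr].
rewrite -integral_cst//=; apply: ge0_le_integral => //=.
- by move=> z _; rewrite lee_fin normal_pdf_ge0.
- exact: measurable_pdf.
- by move=> z zab; rewrite lee_fin; apply: pdf_anti; apply: H; rewrite in_itv in zab.
Qed.

Lemma normal_prob_itv_le V a b r : measurable V -> a <= b -> V `<=` `]a, b[ ->
    (forall z, V z -> `|r| <= `|z|) ->
  fine (normal_prob 0 sigma V) <= (b - a) * normal_pdf 0 sigma r.
Proof.
move=> mV ab Vab H; rewrite -lee_fin fineK ?fin_num_measure//.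
have labE : lebesgue_measure `]a, b[%classic = (b - a)%:E.
  rewrite lebesgue_measure_itv/= lte_fin; case: ltP => // ba.
  by have -> : a = b; [apply/le_anti; rewrite ab|rewrite subrr].
apply: (@le_trans _ _ (\int[lebesgue_measure]_(z in V) (pdf r)%:E)%E).
  apply: ge0_le_integral => //=.
  - by move=> z _; rewrite lee_fin normal_pdf_ge0.
  - exact: measurable_pdf.
  - by move=> z Vz; rewrite lee_fin; apply: pdf_anti; exact: H.
rewrite integral_cst//= mulrC EFinM lee_pmul2l ?lte_fin//.
by rewrite -labE le_measure ?inE.
Qed.

Lemma normal_prob_itv_gt0 a b : a < b -> 0 < fine (normal_prob 0 sigma `]a, b[).
Proof.
(* Every point of the interval has absolute value at most |a| + |b|. *)
move=> ab; apply: lt_le_trans (normal_prob_itv_ge (r := `|a| + `|b|) (ltW ab) _).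
  by rewrite mulr_gt0 ?subr_gt0// pdf_gt0.
move=> z /andP[az zb].
rewrite (@ger0_norm _ (`|a| + `|b|)) ?addr_ge0// ler_norml.
have := ler_norm b; have := ler_norm (- a); rewrite normrN.
have := normr_ge0 a; have := normr_ge0 b; lra.
Qed.

Lemma trunc_normal_ge0 a b B : 0 <= trunc_normal sigma a b B.
Proof. by rewrite divr_ge0 ?fine_ge0. Qed.

Lemma trunc_normalT a b : a < b -> trunc_normal sigma a b setT = 1.
Proof. by move=> ab; rewrite /trunc_normal setTI divff ?gt_eqF ?normal_prob_itv_gt0. Qed.

Lemma trunc_normal_disjoint a b B : B `&` `]a, b[ = set0 ->
  trunc_normal sigma a b B = 0.
Proof. by rewrite /trunc_normal => ->; rewrite measure0 mul0r. Qed.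

(* The normal density is at most its value at r = delta (W - 1) on the tail,
   and at least its value at r / 2 on a subinterval of length r / 2. *)
Lemma trunc_normal_tail W p delta : 1 < W -> 0 <= p <= 1 -> 0 < delta <= 1 ->
    4 / delta ^+ 2 <= (W - 1) / sigma ->
  trunc_normal sigma (tr_a W p) (tr_b W p) [set z | delta * (W - 1) < `|z|] <= delta.
Proof.
move=> W1 /andP[p0 p1] /andP[d0 d1] big.
set D := W - 1; have D0 : 0 < D by rewrite subr_gt0.
have ab : tr_a W p <= tr_b W p by rewrite /tr_a /tr_b -/D; nra.
have baD : tr_b W p - tr_a W p = D by rewrite /tr_a /tr_b -/D; ring.
set r := delta * D; have r0 : 0 < r by rewrite mulr_gt0.
have rD : r <= D by rewrite ler_piMl// ltW.
have num : fine (normal_prob 0 sigma ([set z | r < `|z|] `&` `]tr_a W p, tr_b W p[))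
    <= D * pdf r.
  rewrite -baD; apply: normal_prob_itv_le => //.
    by apply: measurableI => //; exact: measurable_norm_gt.
  by move=> z [/= rz _]; rewrite (gtr0_norm r0) ltW.
(* The truncation interval contains 0 in its closure and has length D >= r, so it contains ]0,
   r/2[ when p <= 1/2 and ]-r/2, 0[ otherwise. *)
have den : r / 2 * pdf (r / 2) <= fine (normal_prob 0 sigma `]tr_a W p, tr_b W p[).
  have [p2|p2] := leP p 2^-1.
    apply: (@le_trans _ _ (fine (normal_prob 0 sigma `]0, r / 2[))).
      rewrite -[X in X * _]subr0; apply: normal_prob_itv_ge; first lra.
      by move=> z /andP[z0 zr]; rewrite !gtr0_norm//; lra.
    rewrite fine_le ?fin_num_measure// le_measure ?inE//.
    by move=> z /=; rewrite !in_itv/= /tr_a /tr_b -/D => /andP[z0 zr]; nra.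
  apply: (@le_trans _ _ (fine (normal_prob 0 sigma `](- (r / 2)), 0[))).
    rewrite -[X in X * _]opprK -[X in X * _]sub0r.
    apply: normal_prob_itv_ge; first lra.
    move=> z /andP[z0 zr]; rewrite ltr0_norm// gtr0_norm//; lra.
  rewrite fine_le ?fin_num_measure// le_measure ?inE//.
  by move=> z /=; rewrite !in_itv/= /tr_a /tr_b -/D => /andP[z0 zr]; nra.
rewrite ler_pdivrMr; last first.
  by apply: lt_le_trans den; rewrite mulr_gt0 ?divr_gt0 ?pdf_gt0.
apply: (le_trans num); apply: (@le_trans _ _ (delta * (r / 2 * pdf (r / 2)))); last first.
  by rewrite ler_pM2l.
pose y := (D / sigma) ^+ 2.
(* The exponents at r and r/2 differ by (r^2 - r^2/4) / (2 sigma^2) = 3/8 delta^2 y. *)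
have ypdf : pdf r = expR (- (3 / 8 * (delta ^+ 2 * y))) * pdf (r / 2).
  rewrite !pdfE [RHS]mulrCA -expRD; congr (_ * expR _).
  by rewrite /y /r; field; rewrite gt_eqF.
have ybig : 16 <= delta ^+ 4 * y.
  have : (4 / delta ^+ 2) ^+ 2 <= y.
    by rewrite ler_sqr ?nnegrE ?divr_ge0 ?exprn_ge0 ?(ltW d0) ?(ltW sigma0) ?(ltW D0).
  rewrite expr_div_n -exprM ler_pdivrMr ?exprn_gt0//.
  by rewrite mulrC; apply: le_trans; lra.
(* This linear bound reduces the goal to delta^2/2 + 3/16 delta^4 y >= 1, which follows from
   [ybig]. *)
have E1 := expR_ge1Dx (3 / 8 * (delta ^+ 2 * y)).
rewrite ypdf mulrA [leRHS]mulrA ler_pM2r ?pdf_gt0//.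
rewrite expRN ler_pdivrMr ?expR_gt0//.
have -> : delta * (r / 2) = D * (delta ^+ 2 / 2) by rewrite /r; ring.
rewrite -[leLHS]mulr1 -[leRHS]mulrA ler_pM2l//.
apply: (@le_trans _ _ (delta ^+ 2 / 2 * (1 + 3 / 8 * (delta ^+ 2 * y)))); last first.
  by rewrite ler_pM2l// divr_gt0// exprn_gt0.
have -> : delta ^+ 2 / 2 * (1 + 3 / 8 * (delta ^+ 2 * y)) =
  delta ^+ 2 / 2 + 3 / 16 * (delta ^+ 4 * y) by field.
have := sqr_ge0 delta; lra.
Qed.

End truncated_normal.

(** * Products of step functions under the product measure *)

Section product_step_functions.
Variables (R : realType) (nu0 : probability R R) (W sigma : R).
Variable mu0 : probability (SeqSpace R) R.
Hypothesis mu0P : is_product_measure nu0 W sigma mu0.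

Context (J : finType) (A B : J -> set R) (c v : J -> R).
Hypothesis mA : forall j, measurable (A j).
Hypothesis mB : forall j, measurable (B j).
Hypothesis c0 : forall j, 0 <= c j.
Hypothesis vE : forall j, nu_tilde nu0 W sigma (A j) (B j) = (v j)%:E.

Definition step_fun (y : R * R) : R :=
  \sum_j c j * (\1_(A j) y.1 * \1_(B j) y.2).

Lemma step_fun_ge0 y : 0 <= step_fun y.
Proof. by apply: sumr_ge0 => j _; rewrite mulr_ge0// mulr_ge0. Qed.

Lemma measurable_prod_step n :
  measurable_fun setT (fun x : SeqSpace R => \prod_(i < n) step_fun (x i)).
Proof.
apply: measurable_prod => i _; apply: measurable_sum => j.
apply: measurable_funM => //; apply: measurable_funM.
  have mI : measurable_fun [set: R] (\1_(A j) : R -> R) by exact: measurable_indic.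
  exact: (measurableT_comp mI (@measurable_coord1 R i)).
have mI : measurable_fun [set: R] (\1_(B j) : R -> R) by exact: measurable_indic.
exact: (measurableT_comp mI (@measurable_coord2 R i)).
Qed.

(** Expanding the product of sums gives one term per map from ['I_n] to [J]: a constant times the
    indicator of a finite-dimensional rectangle, whose mass [mu0P] prescribes. *)
Lemma integral_prod_step n :
  (\int[mu0]_x (\prod_(i < n) step_fun (x i))%:E =
   ((\sum_j c j * v j) ^+ n)%:E)%E.
Proof.
(* [is_product_measure] expects families indexed by all naturals; the coordinates from n on get the
   whole line. *)
pose ext (D : J -> set R) (f : {ffun 'I_n -> J}) (i : nat) : set R :=
  if insub i is Some o then D (f o) else setT.
have extE D f (o : 'I_n) : ext D f o = D (f o) by rewrite /ext valK.
have mext D f i : (forall j, measurable (D j)) -> measurable (ext D f i).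
  by move=> mD; rewrite /ext; case: insubP.
pose C f := [set x : SeqSpace R |
  forall i, (i < n)%N -> ext A f i (x i).1 /\ ext B f i (x i).2].
have mC f : measurable (C f).
  rewrite (_ : C f = \bigcap_(i in [set i | (i < n)%N])
    [set x : SeqSpace R | ext A f i (x i).1 /\ ext B f i (x i).2]) //.
  apply: bigcap_measurableType => i _.
  by apply: measurable_rectangle; exact: mext.
have muC f : mu0 (C f) = (\prod_(i < n) v (f i))%:E.
  rewrite mu0P; last by move=> i; split; exact: mext.
  by rewrite -prodEFin; apply: eq_bigr => i _; rewrite !extE.
have prodE (x : SeqSpace R) : \prod_(i < n) step_fun (x i) =
    \sum_(f : {ffun 'I_n -> J}) (\prod_(i < n) c (f i)) * \1_(C f) x.
  rewrite /step_fun bigA_distr_bigA/=; apply: eq_bigr => f _.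
  rewrite big_split/=; congr (_ * _).
  rewrite indicE; have [|] := boolP (x \in C f); rewrite ?inE ?notin_setE => Cx.
    rewrite big1// => i _; have := Cx i (ltn_ord i); rewrite !extE => -[a b].
    by rewrite !indicE !mem_set// mulr1.
  have [i Ci] : exists i : 'I_n, ~ (A (f i) (x i).1 /\ B (f i) (x i).2).
    apply: contra_notP Cx => /forallNP H i ni.
    by have := H (Ordinal ni); rewrite notK -!(extE _ _ (Ordinal ni)).
  rewrite (bigD1 i)//= !indicE.
  have [a|a] := pselect (A (f i) (x i).1); last by rewrite (memNset a) !mul0r.
  have [b|b] := pselect (B (f i) (x i).2); last by rewrite (memNset b) mulr0 mul0r.
  by exfalso; apply: Ci.
under eq_integral do rewrite prodE -sumEFin.
rewrite ge0_integral_sum//; last 2 first.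
- move=> f; apply/measurable_EFinP; apply: measurable_funM => //.
- by move=> f x _; rewrite lee_fin mulr_ge0// prodr_ge0.
have -> : (\sum_j c j * v j) ^+ n = \prod_(i < n) \sum_j c j * v j.
  by rewrite prodr_const card_ord.
rewrite bigA_distr_bigA/= -sumEFin; apply: eq_bigr => f _.
under eq_integral do rewrite EFinM.
rewrite ge0_integralZl//; last 2 first.
- by apply/measurable_EFinP.
- by rewrite lee_fin prodr_ge0.
rewrite integral_indic// setIT big_split EFinM; congr (_ * _)%E; exact: muC.
Qed.

Lemma ae_prod_step_cvg0 : \sum_j c j * v j < 1 ->
  {ae mu0, forall x : SeqSpace R,
    \prod_(i < n) step_fun (x i) @[n --> \oo] --> (0 : R)}.
Proof.
move=> rho1.
apply: (@ae_cvg0_geometric_mean _ _ _ mu0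
  (fun n (x : SeqSpace R) => \prod_(i < n) step_fun (x i)) (\sum_j c j * v j)).
- exact: measurable_prod_step.
- by move=> n x; apply: prodr_ge0 => i _; exact: step_fun_ge0.
- rewrite rho1 andbT sumr_ge0// => j _; rewrite mulr_ge0//.
  rewrite -lee_fin -vE integral_ge0// => p _.
  by rewrite lee_fin divr_ge0 ?fine_ge0.
- by move=> n; rewrite integral_prod_step.
Qed.

End product_step_functions.

(* The integral of a nonnegative function is a supremum over simple functions,
   so no measurability is needed; this spares proving that [trunc_normal]
   depends measurably on [p]. *)
Lemma ge0_le_integral_nonmeasurable d (T : measurableType d) (R : realType)
    (mu : {measure set T -> \bar R}) (D : set T) (f g : T -> \bar R) :
  (forall x, D x -> (0 <= f x)%E) -> (forall x, D x -> (f x <= g x)%E) ->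
  (\int[mu]_(x in D) f x <= \int[mu]_(x in D) g x)%E.
Proof.
move=> f0 fg; have g0 x : D x -> (0 <= g x)%E.
  by move=> Dx; apply: le_trans (fg x Dx); exact: f0.
rewrite !ge0_integralE//; apply: le_ereal_sup.
move=> _ [s /= sf <-]; exists s => // x; apply: le_trans (sf x) _.
by apply: lee_restrict.
Qed.

(** * The one-coordinate law and its support *)

Section marginals.
Variables (R : realType) (nu0 : probability R R) (W sigma : R).
Hypothesis nu0_01 : nu0 `[0%R, 1%R]%classic = 1%E.
Hypotheses (W1 : 1 < W) (sigma0 : 0 < sigma).
Implicit Types (A B : set R).

Let tr_lt p : tr_a W p < tr_b W p.
Proof. rewrite /tr_a /tr_b; move: W1; nra. Qed.

Lemma nu_tilde_setT A : measurable A -> nu_tilde nu0 W sigma A setT = nu0 A.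
Proof.
move=> mA; rewrite /nu_tilde; under eq_integral do rewrite trunc_normalT//.
by rewrite integral_cst//= mul1e.
Qed.

Lemma nu_tilde_le A B c : measurable A ->
  (forall p, A p -> trunc_normal sigma (tr_a W p) (tr_b W p) B <= c) ->
  (nu_tilde nu0 W sigma A B <= c%:E * nu0 A)%E.
Proof.
move=> mA H; rewrite -integral_cst//.
apply: ge0_le_integral_nonmeasurable => p Ap; rewrite lee_fin//=.
  exact: trunc_normal_ge0.
exact: H.
Qed.

Variable mu0 : probability (SeqSpace R) R.
Hypothesis mu0P : is_product_measure nu0 W sigma mu0.

(** As the law of one coordinate, [nu_tilde] inherits finiteness and additivity from [mu0]; deriving
    additivity from the integral would call for measurability of [trunc_normal] in p. *)
Lemma product_measure_coord i A B : measurable A -> measurable B ->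
  mu0 [set x : SeqSpace R | A (x i).1 /\ B (x i).2] = nu_tilde nu0 W sigma A B.
Proof.
move=> mA mB.
pose A' j := if j == i then A else setT; pose B' j := if j == i then B else setT.
have mAB j : measurable (A' j) /\ measurable (B' j) by rewrite /A' /B'; case: ifP.
rewrite (_ : [set x | _] = [set x : SeqSpace R |
    forall j, (j < i.+1)%N -> A' j (x j).1 /\ B' j (x j).2]); last first.
  apply/seteqP; split => x /=; rewrite /A' /B'.
    by move=> xi j _; case: eqP => // ->.
  by move=> /(_ i (ltnSn i)); rewrite eqxx.
rewrite (mu0P i.+1 mAB) big_ord_recr/= /A' /B' eqxx big1 ?mul1e// => j _.
by rewrite (ltn_eqF (ltn_ord j)) nu_tilde_setT// probability_setT.
Qed.

Lemma nu_tilde_fin_num A B : measurable A -> measurable B ->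
  nu_tilde nu0 W sigma A B \is a fin_num.
Proof.
move=> mA mB; rewrite -(product_measure_coord 0 mA mB).
by apply: fin_num_measure; exact: measurable_rectangle.
Qed.

Lemma nu_tilde_splitr A B : measurable A -> measurable B ->
  (nu_tilde nu0 W sigma A B + nu_tilde nu0 W sigma A (~` B) = nu0 A)%E.
Proof.
move=> mA mB; have mBC : measurable (~` B) by exact: measurableC.
rewrite -nu_tilde_setT//.
rewrite -(product_measure_coord 0 mA mB) -(product_measure_coord 0 mA mBC).
rewrite -(product_measure_coord 0 mA measurableT).
rewrite -measureU; [|exact: measurable_rectangle..|].
- congr (mu0 _); apply/seteqP; split => x /=; first by case=> -[].
  by case=> a _; have [b|b] := pselect (B (x 0%N).2); [left|right].
- by apply/seteqP; split => x //= [[_ b] [_]].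
Qed.

Lemma nu_tilde_out B : measurable B -> nu_tilde nu0 W sigma (~` `[0%R, 1%R]) B = 0%E.
Proof.
move=> mB; have mI : measurable (~` `[0%R, 1%R]%classic : set R) by exact: measurableC.
apply/eqP; rewrite eq_le -{2}(product_measure_coord 0 mI mB) measure_ge0 andbT.
apply: (@le_trans _ _ (nu0 (~` `[0%R, 1%R]%classic))).
  rewrite -(nu_tilde_splitr mI mB) leeDl//.
  by rewrite -(product_measure_coord 0 mI (measurableC mB)) measure_ge0.
by rewrite probability_setC// nu0_01 subee.
Qed.

(** Values of p outside [0,1] carry no mass, so the tail estimate, which holds for p in [0,1], is
    enough. *)
Lemma nu_tilde_le01 A B c : measurable A -> measurable B ->
  (forall p, 0 <= p <= 1 -> trunc_normal sigma (tr_a W p) (tr_b W p) B <= c) ->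
  (nu_tilde nu0 W sigma A B <= c%:E)%E.
Proof.
move=> mA mB H; have mI : measurable (`[0%R, 1%R]%classic : set R) by [].
have mIC := measurableC mI.
rewrite -(product_measure_coord 0 mA mB).
pose S (D : set R) := [set x : SeqSpace R | D (x 0%N).1 /\ B (x 0%N).2].
have mS D : measurable D -> measurable (S D) by move=> mD; exact: measurable_rectangle.
apply: (@le_trans _ _ (mu0 (S `[0%R, 1%R]%classic `|` S (~` `[0%R, 1%R]%classic)))).
  apply: le_measure; rewrite ?inE; [exact: mS|by apply: measurableU; exact: mS|].
  by move=> x [_ b]; have [a|a] := pselect (`[0%R, 1%R]%classic (x 0%N).1); [left|right].
apply: (le_trans (measureU2 _ _ _)); [exact: mS..|].
rewrite [X in (X + _)%E](product_measure_coord 0 mI mB).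
rewrite [X in (_ + X)%E](product_measure_coord 0 mIC mB) nu_tilde_out// adde0.
apply: (le_trans (nu_tilde_le (c := c) _ _)) => //.
by rewrite nu0_01 mule1.
Qed.

(** For p in [0,1] the truncation interval lies inside ]-(W-1), W-1[, so larger noise has
    conditional mass 0. Countably many coordinates are then combined. *)
Lemma ae_coord_bounds : {ae mu0, forall x : SeqSpace R,
  forall i, 0 <= (x i).1 <= 1 /\ `|(x i).2| <= W - 1}.
Proof.
pose Q (i : nat) (x : SeqSpace R) := 0 <= (x i).1 <= 1 /\ `|(x i).2| <= W - 1.
suff H i : \forall x \ae mu0, Q i x by exact: (@ae_foralln _ _ _ mu0 Q H).
pose I01 : set R := `[0%R, 1%R]%classic.
pose far : set R := [set z | W - 1 < `|z|].
have mfar : measurable far by exact: measurable_norm_gt.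
have mI : measurable I01 by exact: measurable_itv.
pose S1 := [set x : SeqSpace R | (~` I01) (x i).1 /\ setT (x i).2].
pose S2 := [set x : SeqSpace R | I01 (x i).1 /\ far (x i).2].
have mS1 : measurable S1 by apply: measurable_rectangle => //; exact: measurableC.
have mS2 : measurable S2 by exact: measurable_rectangle.
exists (S1 `|` S2); split; first exact: measurableU.
- apply/eqP; rewrite -measure_le0; apply: (le_trans (measureU2 _ _ _)) => //.
  rewrite [X in (X + _)%E](product_measure_coord i (measurableC mI) measurableT).
  rewrite [X in (_ + X)%E](product_measure_coord i mI mfar).
  rewrite nu_tilde_out// add0e /nu_tilde integral0_eq// => p /= p01.
  congr (_%:E); apply: trunc_normal_disjoint; apply/seteqP; split => z //= [].
  rewrite /far/= in_itv/= /tr_a /tr_b => + /andP[az zb].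
  move: p01; rewrite /I01/= in_itv/= => /andP[p0 p1]; rewrite ltNge => /negP; apply.
  by rewrite ler_norml; move: W1 => ?; nra.
- move=> x /= /not_andP bad; have [a|a] := pselect (I01 (x i).1); last by left.
  right; split => //; rewrite /far/= ltNge; apply/negP => b.
  by case: bad => [[]|[]] //; move: a; rewrite /I01/= in_itv.
Qed.

End marginals.

(** * Lower bound on the drift, and choice of h and k *)

Section drift.
Variable R : realType.

(** As |2p - 1| <= 1, the noise costs at most |e|, hence at most delta (W-1) off the tail and W-1 on
    it. The noiseless part is at least (2h-1)(W-1) h^k for p >= h, nonnegative for 1/2 <= p < h, and
    at least -(1 + 2^-k (W-1)) for p < 1/2. *)
Lemma weight_drift_ge (W h delta p e : R) (k : nat) :
    1 < W -> 2^-1 <= h -> 0 <= delta -> 0 <= p <= 1 -> `|e| <= W - 1 ->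
  (if h <= p then (2 * h - 1) * (W - 1) * h ^+ k else 0)
    - (1 + 2^-1 ^+ k * (W - 1) + delta * (W - 1))
    - (if delta * (W - 1) < `|e| then W - 1 else 0)
  <= weight W k (p, e) * (2 * p - 1).
Proof.
move=> W1 h2 d0 /andP[p0 p1] eW; rewrite /weight/=.
set D := W - 1 in eW *; have D0 : 0 < D by rewrite subr_gt0.
have dD : 0 <= delta * D by rewrite mulr_ge0 ?(ltW D0).
set K := 2^-1 ^+ k; have K0 : 0 <= K by rewrite exprn_ge0 ?invr_ge0.
have KD : 0 <= K * D by rewrite mulr_ge0 ?(ltW D0).
have He : - (delta * D) - (if delta * D < `|e| then D else 0) <= e * (2 * p - 1).
  have : - `|e| <= e * (2 * p - 1).
    have : `|e * (2 * p - 1)| <= `|e|.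
      by rewrite normrM ler_piMr// ler_norml; lra.
    by rewrite ler_norml => /andP[].
  by case: ltP => ?; lra.
have HF : (if h <= p then (2 * h - 1) * D * h ^+ k else 0) - (1 + K * D)
    <= (1 + D * p ^+ k) * (2 * p - 1).
  have pk0 : 0 <= p ^+ k by rewrite exprn_ge0.
  have Dpk0 : 0 <= D * p ^+ k by rewrite mulr_ge0// ltW.
  case: (leP h p) => hp.
    have hk : h ^+ k <= p ^+ k by rewrite lerXn2r ?nnegrE//; lra.
    have Dhk : D * h ^+ k <= D * p ^+ k by rewrite ler_pM2l.
    have Dhk0 : 0 <= D * h ^+ k by rewrite mulr_ge0 ?ltW// exprn_gt0//; lra.
    have A1 : (2 * h - 1) * (D * h ^+ k) <= (2 * p - 1) * (D * p ^+ k).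
      by apply: ler_pM => //; lra.
    by rewrite -mulrA; lra.
  have [p2|p2] := leP 2^-1 p.
    have : 0 <= (1 + D * p ^+ k) * (2 * p - 1) by rewrite mulr_ge0//; lra.
    by lra.
  have pk : p ^+ k <= K by rewrite lerXn2r ?nnegrE ?(ltW p2) ?invr_ge0.
  have Dpk : D * p ^+ k <= K * D by rewrite mulrC ler_pM2r.
  have A1 : (1 + D * p ^+ k) * (1 - 2 * p) <= 1 + D * p ^+ k.
    by rewrite ler_piMr//; lra.
  by lra.
rewrite [leRHS]mulrDl; apply: le_trans (lerD HF He).
set X := (if h <= p then _ else _); set Y := (if _ < _ then _ else _).
by rewrite le_eqVlt; apply/orP; left; apply/eqP; ring.
Qed.

(** By Bernoulli's inequality. With a = 2h this makes h^k exceed any given multiple of 2^-k. *)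
Lemma expr_unbounded (a M : R) : 1 < a -> exists k : nat, (0 < k)%N /\ M <= a ^+ k.
Proof.
move=> a1.
have bern n : 1 + n%:R * (a - 1) <= a ^+ n.
  elim: n => [|n ih]; first by rewrite mul0r addr0 expr0.
  rewrite exprS -[n.+1]addn1 natrD.
  apply: (@le_trans _ _ (a * (1 + n%:R * (a - 1)))); last by rewrite ler_pM2l//; lra.
  have := ler0n R n; have : 0 <= (a - 1) ^+ 2 by exact: sqr_ge0.
  set m := n%:R => s0 m0; have : 0 <= m * (a - 1) ^+ 2 by exact: mulr_ge0.
  lra.
pose n := (Num.truncn (`|M| / (a - 1))).+1.
exists n; split => //; apply: le_trans (bern n).
have : `|M| / (a - 1) < n%:R by exact: truncnS_gt.
rewrite ltr_pdivrMr ?subr_gt0// => H.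
by have := ler_norm M; move: H; set y := _ * (a - 1); lra.
Qed.

(** Countably many half-lines [[h, +oo[] with 1/2 < h <= 1 cover ]1/2, 1], so they cannot all be
    null. *)
Lemma threshold_above_half (nu0 : probability R R) :
  (0 < nu0 (`](2^-1)%R, 1%R]%classic : set R))%E ->
  exists h : R, 2^-1 < h <= 1 /\ (0 < nu0 `[h, +oo[%classic)%E.
Proof.
move=> nu0_gt0; apply: contrapT => /forallNP H.
(* Starting at 1/2 + 1/2 keeps every threshold at most 1. *)
pose a (m : nat) : R := 2^-1 + m.+2%:R^-1.
have a2 m : 2^-1 < a m <= 1.
  have y2 : (m.+2%:R : R)^-1 <= 2^-1 by rewrite lef_pV2 ?posrE// ler_nat.
  have y0 : 0 < (m.+2%:R : R)^-1 by rewrite invr_gt0.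
  rewrite /a; move: (m.+2%:R^-1) y0 y2 => y y0 y2; lra.
have null m : nu0 `[a m, +oo[%classic = 0%E.
  apply/eqP; rewrite eq_le measure_ge0 andbT leNgt; apply/negP => pos.
  by apply: (H (a m)).
suff : nu0 (`](2^-1)%R, 1%R]%classic : set R) = 0%E.
  by move=> E; rewrite E ltxx in nu0_gt0.
apply/negligibleP => //.
apply: (@negligibleS _ _ _ _ (\bigcup_m `[a m, +oo[%classic)); last first.
  apply: negligible_bigcup => m; apply/negligibleP; [exact: measurable_itv|exact: null].
move=> z /=; rewrite in_itv/= => /andP[z2 _].
have [m Hm] := ltr_add_invr z2.
exists m => //=; rewrite in_itv/= andbT; apply: le_trans (ltW Hm).
by rewrite /a lerD2l lef_pV2 ?posrE// ler_nat.
Qed.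

End drift.

(** * The jury property holds almost surely under the product measure *)

Lemma CJP_set_ae (R : realType) (nu0 : probability R R) (W sigma h : R) (k : nat)
    (mu0 : probability (SeqSpace R) R) :
  nu0 `[0%R, 1%R]%classic = 1%E ->
  1 < W -> 0 < sigma -> 2^-1 < h <= 1 ->
  4 <= (2 * h) ^+ k * ((2 * h - 1) * fine (nu0 `[h, +oo[%classic)) ->
  4 / 2^-1 ^+ k <= W - 1 -> 4 / (2^-1 ^+ k / 4) ^+ 2 <= (W - 1) / sigma ->
  is_product_measure nu0 W sigma mu0 ->
  {ae mu0, forall x : SeqSpace R, CJP_set W k x}.
Proof.
move=> nu0_01 W1 sigma0 /andP[h2 h1] hk WK sK mu0P.
set q := fine _ in hk.
set K := 2^-1 ^+ k in WK sK; have K0 : 0 < K by rewrite exprn_gt0 ?invr_gt0.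
have K1 : K <= 1 by rewrite exprn_ile1 ?invr_ge0// invf_le1// ler1n.
set D := W - 1 in WK sK; have D0 : 0 < D by rewrite subr_gt0.
pose delta := K / 4; have d0 : 0 < delta by rewrite divr_gt0.
have d1 : delta <= 1 by rewrite /delta; lra.
(* All losses are measured in units of m: the constant 1 in the weight is at most m/4, and noise
   below the threshold costs delta D = m/4. *)
pose m := K * D; have m0 : 0 < m by rewrite mulr_gt0.
have m4 : 4 <= m by rewrite /m mulrC -ler_pdivrMr.
have mD : m <= D by rewrite /m ler_piMl// ltW.
pose M := 2 * W; have M0 : 0 < M by rewrite mulr_gt0//; lra.
(* [m] bounds the mean drift from below and [M] the weights from above; this [t]
   minimises 1 - t m + 2 (t M)^2. *)
pose t := m / (4 * M ^+ 2); have t0 : 0 < t by rewrite divr_gt0// mulr_gt0// exprn_gt0.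
have tM : t * M = m / (4 * M) by rewrite /t; field; rewrite gt_eqF.
have tM2 : t * M <= 2^-1.
  rewrite tM ler_pdivrMr ?mulr_gt0//; move: mD; rewrite /M /D; lra.
pose alpha := (2 * h - 1) * D * h ^+ k.
have alpha0 : 0 <= alpha.
  by rewrite !mulr_ge0// ?exprn_ge0 ?(ltW D0)//; lra.
have alphaM : alpha <= M.
  apply: (@le_trans _ _ D); last by rewrite /M /D; lra.
  rewrite /alpha mulrAC ler_piMl ?(ltW D0)//.
  rewrite mulr_ile1 ?exprn_ge0 ?exprn_ile1//; lra.
pose beta := 1 + K * D + delta * D.
have dD : delta * D = m / 4 by rewrite /delta /m; field.
(* Since h^k = K (2h)^k, the gain alpha is m (2h)^k (2h-1); this is where k must be large. *)
have alphaq : 4 * m <= alpha * q.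
  have -> : alpha * q = m * ((2 * h) ^+ k * ((2 * h - 1) * q)).
    rewrite /alpha /m exprMn /K exprVn; field.
    by rewrite expf_neq0// gt_eqF.
  by rewrite mulrC ler_pM2l.
(* Complements in the whole line make the four rectangles a partition of the plane, so each pair (p,
   e) lies in exactly one. *)
pose high (a : bool) : set R := if a then `[h, +oo[%classic else ~` `[h, +oo[%classic.
pose tail : set R := [set z | delta * D < `|z|].
pose far (b : bool) : set R := if b then tail else ~` tail.
have mtail : measurable tail by exact: measurable_norm_gt.
have mhigh a : measurable (high a).
  by case: a; [exact: measurable_itv|apply: measurableC; exact: measurable_itv].
have mfar b : measurable (far b) by case: b; [exact: mtail|exact: measurableC].
(* The bound of [two_point_mgf_le] with |w| replaced by M and the drift by its lower bound from
   [weight_drift_ge]. *)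
pose c (j : bool * bool) : R := 1 + 2 * (t * M) ^+ 2 + t * beta
  - (if j.1 then t * alpha else 0) + (if j.2 then t * D else 0).
pose v (j : bool * bool) : R := fine (nu_tilde nu0 W sigma (high j.1) (far j.2)).
have c0 j : 0 <= c j.
  have := sqr_ge0 (t * M).
  have : 0 <= t * beta by rewrite mulr_ge0 ?(ltW t0)// /beta dD -/m; lra.
  have : t * alpha <= 2^-1 by apply: le_trans tM2; rewrite ler_pM2l.
  have : 0 <= t * D by rewrite mulr_ge0 ?ltW.
  rewrite /c; clear; clearbody beta alpha t M D.
  by case: ifP; case: ifP; lra.
have vE j : nu_tilde nu0 W sigma (high j.1) (far j.2) = (v j)%:E.
  by rewrite /v fineK// (nu_tilde_fin_num W1 sigma0 mu0P).
have vsum a : v (a, true) + v (a, false) = fine (nu0 (high a)).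
  have fin B : measurable B -> nu_tilde nu0 W sigma (high a) B \is a fin_num.
    exact: (nu_tilde_fin_num W1 sigma0 mu0P).
  rewrite -(nu_tilde_splitr W1 sigma0 mu0P (mhigh a) mtail).
  by rewrite fineD ?fin//; exact: measurableC.
have vtail a : v (a, true) <= delta.
  rewrite -lee_fin -vE; apply: (nu_tilde_le01 nu0_01 W1 sigma0 mu0P) => //.
  by move=> p p01; apply: trunc_normal_tail; rewrite ?d0.
have vfalse : v (false, true) + v (false, false) = 1 - q.
  rewrite vsum /= probability_setC// fineB//; first exact: fin_num_measure.
(* The gain alpha q is at least 4m, beta is at most 3m/2, and the tails cost at most D (2 delta) =
   m/2, so the mean drift exceeds m. The quadratic term equals t m / 2, leaving a mean of at most 1
   - t m / 2. *)
have rho1 : \sum_j c j * v j < 1.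
  rewrite -(pair_bigA _ (fun a b => c (a, b) * v (a, b))) /= !big_bool /c /=.
  have := vsum true; rewrite /= -/q => vtrue.
  have := vtail true; have := vtail false.
  set x1 := v (true, true) in vtrue *; set x2 := v (true, false) in vtrue *.
  set x3 := v (false, true) in vfalse *; set x4 := v (false, false) in vfalse *.
  move=> x3d x1d.
  apply: (@le_lt_trans _ _ (1 + 2 * (t * M) ^+ 2
      - t * (alpha * q - beta - D * (x1 + x3)))).
    have -> : x4 = 1 - q - x3 by lra.
    have -> : x2 = q - x1 by lra.
    by rewrite le_eqVlt; apply/orP; left; apply/eqP; ring.
  have Dx : D * (x1 + x3) <= m / 2.
    apply: (@le_trans _ _ (D * (2 * delta))); first by rewrite ler_pM2l//; lra.
    by move: dD; lra.
  have tm : t * m <= t * (alpha * q - beta - D * (x1 + x3)).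
    by rewrite ler_pM2l// /beta dD -/m; lra.
  have E2 : 2 * (t * M) ^+ 2 = t * m / 2.
    by rewrite /t; field; rewrite gt_eqF.
  have : 0 < t * m by rewrite mulr_gt0.
  lra.
have cv := ae_prod_step_cvg0 mu0P (fun j => mhigh j.1) (fun j => mfar j.2) c0 vE rho1.
have bnd := ae_coord_bounds nu0_01 W1 sigma0 mu0P.
apply: filterS2 cv bnd => x cvx xb.
rewrite /CJP_set /=.
have bounds n : 1 - \prod_(i < n) step_fun (fun j => high j.1) (fun j => far j.2) c (x i)
    <= vote_prob W k x n <= 1.
  have [|le1 ge] := @vote_prob_bounds R W k t x n (ltW t0).
    by move=> i _; have [] := xb i.
  rewrite le1 andbT lerBlDl -lerBlDr; apply: (le_trans ge).
  apply: ler_prod => i _; have [/andP[p0 p1] ei] := xb i.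
  rewrite addr_ge0 ?mulr_ge0 ?expR_ge0 ?subr_ge0//=.
  set w := weight W k (x i).
  have wM : `|w| <= M.
    have pk : 0 <= (x i).1 ^+ k <= 1 by rewrite exprn_ge0// exprn_ile1.
    have Dpk : 0 <= D * (x i).1 ^+ k <= D.
      by case/andP: pk => ? ?; rewrite mulr_ge0 ?(ltW D0)// ler_piMr ?(ltW D0).
    rewrite /w /weight /M -/D ler_norml; move: ei; rewrite ler_norml.
    have WD : W = 1 + D by rewrite addrC subrK.
    clear -Dpk WD D0; clearbody D; move: (D * _) Dpk => y.
    by move=> /andP[y0 yD] /andP[eD De]; apply/andP; split; lra.
  have twM : `|t * w| <= t * M by rewrite normrM (gtr0_norm t0) ler_pM2l.
  apply: le_trans (two_point_mgf_le _ _) _; first by rewrite p0.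
    exact: le_trans twM tM2.
  pose j0 := (h <= (x i).1, delta * D < `|(x i).2|).
  apply: (@le_trans _ _ (c j0)).
    have tw2 : (t * w) ^+ 2 <= (t * M) ^+ 2.
      by rewrite -(real_normK (num_real (t * w))) lerXn2r // nnegrE mulr_ge0 ?ltW.
    have := @weight_drift_ge R W h delta (x i).1 (x i).2 k W1 (ltW h2) (ltW d0).
    rewrite p0 p1 -surjective_pairing -/w -/D => /(_ isT ei).
    rewrite -(ler_pM2l t0) -/K -/beta -/alpha /c /j0 /= => drift.
    clear -drift tw2; clearbody w alpha beta t M D.
    by move: drift; case: (h <= _); case: (_ < `|_|); lra.
  (* [j0] indexes the rectangle containing [x i]; the remaining terms are nonnegative. *)
  rewrite /step_fun (bigD1 j0)//= !indicE !mem_set ?mulr1 ?lerDl.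
  - by apply: sumr_ge0 => j _; rewrite mulr_ge0// mulr_ge0.
  - by rewrite /j0 /far /tail /=; case: ifPn => //= H; apply/negP.
  - rewrite /j0 /high /=; case: ifPn => /= H; first by rewrite in_itv/= H.
    by rewrite in_itv/= andbT; apply/negP.
apply: (@squeeze_cvgr _ _ _ _
  (fun n => 1 - \prod_(i < n) step_fun (fun j => high j.1) (fun j => far j.2) c (x i))
  (fun=> 1)); last exact: cvg_cst.
  by apply: nearW.
by rewrite -[X in _ --> X]subr0; apply: cvgB => //; exact: cvg_cst.
Qed.

Theorem theorem3 (R : realType) (nu0 : probability R R) :
  nu0 `[0%R, 1%R]%classic = 1%E ->
  (0 < nu0 (`](2^-1)%R, 1%R]%classic : set R))%E ->
  exists k : nat, (0 < k)%N /\
    exists T : R, forall W sigma : R,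
      1 < W -> 0 < sigma -> T <= W -> T <= (W - 1) / sigma ->
      forall mu0 mu : probability (SeqSpace R) R,
        is_product_measure nu0 W sigma mu0 ->
        mu `<< mu0 ->
        mu (CJP_set W k) = 1%E.
Proof.
move=> nu0_01 nu0_gt0.
have [h [/andP[h2 h1] nuh]] := threshold_above_half nu0_gt0.
have q0 : 0 < fine (nu0 `[h, +oo[%classic).
  by rewrite fine_gt0// nuh/= ltey_eq fin_num_measure.
set q := fine _ in q0.
have g0 : 0 < (2 * h - 1) * q by rewrite mulr_gt0//; lra.
have [k [k0 hk]] := @expr_unbounded R (2 * h) (4 / ((2 * h - 1) * q)) ltac:(lra).
exists k; split => //.
set K : R := 2^-1 ^+ k; have K0 : 0 < K by rewrite exprn_gt0 ?invr_gt0.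
(* One threshold for both conditions: its first two terms give 4/K <= W-1, its last the bound on
   (W-1)/sigma. *)
exists (1 + 4 / K + 4 / (K / 4) ^+ 2) => W sigma W1 sigma0 TW Ts mu0 mu mu0P mumu0.
have a0 : 0 < 4 / K by rewrite divr_gt0.
have b0 : 0 < 4 / (K / 4) ^+ 2 by rewrite !divr_gt0// exprn_gt0// divr_gt0.
have mCJP := @measurable_CJP_set R W k.
have aeCJP : {ae mu0, forall x : SeqSpace R, CJP_set W k x}.
  apply: (@CJP_set_ae R nu0 W sigma h k) => //.
  - by rewrite h2.
  - by rewrite -ler_pdivrMr.
  - by rewrite -/K; lra.
  - by rewrite -/K; lra.
(* Absolute continuity carries null measurable sets of [mu0] to [mu], hence the appeal to [mCJP]. *)
have muC : mu (~` CJP_set W k) = 0%E.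
  move/null_content_dominatesP : mumu0; apply; first exact: measurableC.
  by apply: measure_negligible => //; exact: measurableC.
have := @probability_setC _ _ _ mu _ (measurableC mCJP).
by rewrite setCK muC sube0.
Qed.
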